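(* Let $X$ be a set, $F$ a field, $d$ a positive integer, and $\overline{f} : X \to F^d$ linearly independent. Then $$\operatorname{VCdim}(\mathcal{C}_{\overline{f}}) = \operatorname{Ldim}(\mathcal{C}_{\overline{f}}) = d-1.$$
   Context: Notation: $\mathbb{N}$ includes $0$; $[n]=\{k\in\mathbb{N}: 0\le k<n\}$; ${}^{A}B$ is the set of functions from $A$ to $B$; $\mathcal{P}(X)$ is the power set of $X$. Zero sets: for $\overline{a},\overline{b}\in F^d$, $\overline{a}\cdot\overline{b}=\sum_{i=0}^{d-1}a_ib_i$. For $\overline{f}=(f_0,\dots,f_{d-1}):X\to F^d$ and $\overline{a}\in F^d$, let $Z_{\overline{f},\overline{a}}=\{c\in X:\overline{a}\cdot\overline{f}(c)=0\}$ and $\mathcal{C}_{\overline{f}}=\{Z_{\overline{f},\overline{a}}:\overline{a}\in F^d\setminus\{\overline{0}\}\}\subseteq\mathcal{P}(X)$. The map $\overline{f}$ is called linearly independent if for every $\overline{a}\in F^d\setminus\{\overline{0}\}$ there is $c\in X$ with $\overline{a}\cdot\overline{f}(c)\ne 0$ (equivalently, $f_0,\dots,f_{d-1}$ are linearly independent in the $F$-vector space of functions $X\to F$; equivalently, $\overline{f}(X)$ is not contained in a proper subspace of $F^d$). Trees: let $\mathcal{C}\subseteq\mathcal{P}(X)$ and $n\in\mathbb{N}$. An $(X,\mathcal{C})$-labeled tree of depth $n$ is a function $T:\bigcup_{k\le n}{}^{[k]}[2]\to X\cup\mathcal{C}$ such that $T(\sigma)\in X$ for all $\sigma\in{}^{[k]}[2]$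 with $0\le k<n$, and $T(\tau)\in\mathcal{C}$ for all $\tau\in{}^{[n]}[2]$. For $\tau\in{}^{[n]}[2]$, the leaf $(\tau,T(\tau))$ is well-labeled if for all $0\le k<n$: $T(\tau|_{[k]})\in T(\tau)\iff\tau(k)=1$. $T$ is well-labeled if all its leaves are well-labeled. $T$ is level-balanced if $T(\sigma_0)=T(\sigma_1)$ for all $k<n$ and all $\sigma_0,\sigma_1\in{}^{[k]}[2]$. Dimensions: $\operatorname{Ldim}(\mathcal{C})$ (Littlestone dimension) is the largest $n\in\mathbb{N}$ such that there is a well-labeled $(X,\mathcal{C})$-labeled tree of depth $n$; it is $\infty$ if such trees exist for all $n$, and $-\infty$ if there is none of depth $0$. $\operatorname{VCdim}(\mathcal{C})$ (VC-dimension) is defined identically but using only level-balanced trees; equivalently, it is the largest $n\in\mathbb{N}$ such that some $n$-element $Y\subseteq X$ satisfies $\{A\cap Y:A\in\mathcal{C}\}=\mathcal{P}(Y)$. *)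

(* Defs.v *)
From mathcomp Require Import all_boot all_order all_algebra.
From mathcomp Require Import all_classical all_reals.

Set Implicit Arguments.
Unset Strict Implicit.
Unset Printing Implicit Defensive.

Import GRing.Theory.

Local Open Scope classical_set_scope.
Local Open Scope ring_scope.

Section ZeroSets.
Context {X : Type} {F : fieldType} {d : nat}.
Implicit Types (f : X -> 'rV[F]_d) (a b : 'rV[F]_d).

Definition dot a b : F := \sum_(i < d) a 0 i * b 0 i.

Definition zero_set f a : set X := [set c | dot a (f c) = 0].

Definition zero_set_class f : set (set X) :=
  [set zero_set f a | a in [set a | a != 0]].

Definition lin_indep f : Prop :=
  forall a, a != 0 -> exists c, dot a (f c) <> 0.

End ZeroSets.

(* The restriction of tau to {0, ..., k-1}; bool stands for {0, 1}, with true
   for 1. *)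
Definition restrict (n : nat) (tau : {ffun 'I_n -> bool}) (k : 'I_n) :
    {ffun 'I_k -> bool} :=
  [ffun i => tau (widen_ord (ltnW (ltn_ord k)) i)].

(* A labeling with values in X on the levels k < n and in C on level n is
   presented as two functions, one per kind of label. *)
Record tree (X : Type) (C : set (set X)) (n : nat) := Tree {
  node : forall k : 'I_n, {ffun 'I_k -> bool} -> X;
  leaf : {ffun 'I_n -> bool} -> set X;
  leaf_in : forall tau, C (leaf tau)
}.

Section Dimensions.
Context {X : Type}.
Implicit Types C : set (set X).

Definition well_labeled_leaf C n (T : tree C n) (tau : {ffun 'I_n -> bool}) :
    Prop :=
  forall k : 'I_n, leaf T tau (node T (restrict tau k)) <-> tau k = true.

Definition well_labeled C n (T : tree C n) : Prop :=
  forall tau, well_labeled_leaf T tau.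

Definition level_balanced C n (T : tree C n) : Prop :=
  forall (k : 'I_n) (s0 s1 : {ffun 'I_k -> bool}), node T s0 = node T s1.

Definition is_largest (P : set nat) (n : nat) : Prop :=
  P n /\ forall m, P m -> (m <= n)%N.

(* Only used for sets P of depths of trees; these are closed downwards (truncate
   the tree), so that the last case is exactly ~ P 0. *)
Definition largest (P : set nat) : \bar nat :=
  if pselect (exists n, is_largest P n) is left h then (sval (cid h))%:E
  else if `[< forall n, P n >] then +oo%E else -oo%E.

Definition Ldim C : \bar nat :=
  largest [set n | exists T : tree C n, well_labeled T].

Definition VCdim C : \bar nat :=
  largest [set n | exists T : tree C n, well_labeled T /\ level_balanced T].

End Dimensions.

(* Main.v *)
(** Call vectors [x_k] and functionals [a_k] triangular when [a_k] kills [x_j]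
    for [j < k] but not [x_k]; the vectors are then linearly independent.
    Greedily, linear independence of [f] produces [d] triangular points
    [f (c_k)]; these form a basis of [F^d], so functionals can be prescribed on
    it, and [c_0, ..., c_(d-2)] is shattered, with [c_(d-1)] serving only to
    keep the functional nonzero.
    Conversely, consider the path of always-true branches in a well-labeled tree
    of depth [n]: leaves reached by turning to false at a node of it show that its [n]
    nodes are triangular, and the leaf at its end gives a nonzero functional
    vanishing on all of them, so that [n < d]. *)
Require Import Defs.
From mathcomp Require Import all_boot all_order all_algebra.
From mathcomp Require Import all_classical all_reals.

Set Implicit Arguments.
Unset Strict Implicit.
Unset Printing Implicit Defensive.

Import GRing.Theory.

Local Open Scope classical_set_scope.
Local Open Scope ring_scope.

Lemma is_largest_unique (P : set nat) m n :
  is_largest P m -> is_largest P n -> m = n.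
Proof.
by move=> [Pm maxm] [Pn maxn]; apply/eqP; rewrite eqn_leq maxn ?maxm.
Qed.

(** [largest] picks some maximum by choice; uniqueness forces it to be [n]. *)
Lemma largestE (P : set nat) n : is_largest P n -> largest P = n%:E%E.
Proof.
move=> Pn; rewrite /largest; case: pselect => [h|[]]; last by exists n.
by case: (cid h) => m Pm /=; rewrite (is_largest_unique Pm Pn).
Qed.

Section LinearAlgebra.
Context {F : fieldType} {d : nat}.

Lemma dotE (a b : 'rV[F]_d) : dot a b = (a *m b^T) 0 0.
Proof. by rewrite mxE; apply: eq_bigr => i _; rewrite mxE. Qed.

Lemma mulmx_tr_rows n (x : 'I_n -> 'rV[F]_d) (a : 'rV[F]_d) j :
  (a *m (\matrix_i x i)^T) 0 j = dot a (x j).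
Proof. by rewrite mxE; apply: eq_bigr => i _; rewrite !mxE. Qed.

(** The matrix of all pairings is lower triangular with nonzero diagonal, hence invertible, and its
    rank is at most that of its factor [\matrix_i x i]. *)
Lemma triangular_row_free n (x a : 'I_n -> 'rV[F]_d) :
  (forall j k : 'I_n, (j < k)%N -> dot (a k) (x j) = 0) ->
  (forall k, dot (a k) (x k) <> 0) ->
  row_free (\matrix_i x i).
Proof.
move=> lt0 diag_neq0.
set B := (\matrix_i x i) *m (\matrix_i a i)^T.
have BE j k : B j k = dot (a k) (x j).
  by rewrite mxE; apply: eq_bigr => i _; rewrite !mxE mulrC.
have Bunit : B \in unitmx.
  rewrite unitmxE unitfE det_trig; last first.
    by apply/is_trig_mxP => j k jk; rewrite BE lt0.
  by apply/prodf_neq0 => i _; rewrite BE; apply/eqP.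
have : row_free B by rewrite row_free_unit.
rewrite /row_free !eqn_leq !rank_leq_row => /leq_trans; apply.
exact: mxrankM_maxl.
Qed.

(** When a product is zero, the ranks of its factors add up to at most the inner dimension: here
    [1 + n <= d]. *)
Lemma row_free_orthogonal_lt n (x : 'I_n -> 'rV[F]_d) (a : 'rV[F]_d) :
  row_free (\matrix_i x i) -> a != 0 -> (forall k, dot a (x k) = 0) ->
  (n < d)%N.
Proof.
move=> /eqP rk a0 ax.
have /mulmx0_rank_max : a *m (\matrix_i x i)^T = 0.
  by apply/rowP => j; rewrite mulmx_tr_rows ax mxE.
by rewrite mxrank_tr rk rank_rV a0.
Qed.

Lemma exists_orthogonal n (x : 'I_n -> 'rV[F]_d) :
  (n < d)%N -> exists2 a, a != 0 & forall k, dot a (x k) = 0.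
Proof.
move=> nd; set M := (\matrix_i x i)^T.
have /rowV0Pn [a aM a0] : kermx M != 0.
  rewrite -mxrank_eq0 mxrank_ker subn_eq0 -ltnNge.
  exact: leq_ltn_trans (rank_leq_col _) nd.
exists a => // k; rewrite -mulmx_tr_rows.
by rewrite (sub_kermxP aM) mxE.
Qed.

End LinearAlgebra.

Section ZeroSetDimension.
Context {X : Type} {F : fieldType} {d : nat}.
Variable f : X -> 'rV[F]_d.

Lemma exists_triangular_points : (0 < d)%N -> lin_indep f ->
  forall n, (n <= d)%N -> exists (c : nat -> X) (a : nat -> 'rV[F]_d),
    (forall j k, (j < k < n)%N -> dot (a k) (f (c j)) = 0) /\
    (forall k, (k < n)%N -> dot (a k) (f (c k)) <> 0).
Proof.
move=> d_gt0 f_indep; elim=> [_|n IHn nd].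
  (* Even the empty sequence needs a default point: a nonzero vector exists as [0 < d], and
     independence yields a point of [X] from it. *)
  have [a a0 _] := @exists_orthogonal F d 0 (fun=> 0) d_gt0.
  have [c _] := f_indep a a0.
  by exists (fun=> c), (fun=> 0); split=> [j k|k]; rewrite ?ltn0 ?andbF.
have [c [a [lt0 diag]]] := IHn (ltnW nd).
have [b b0 bc] := exists_orthogonal (fun i : 'I_n => f (c i)) nd.
have [y by_neq0] := f_indep b b0.
exists (fun k => if k == n then y else c k).
exists (fun k => if k == n then b else a k).
split=> [j k /andP[jk]|k]; rewrite ltnS leq_eqVlt.
- case: eqP => [kn _|/= _ kn].
    by rewrite kn in jk; rewrite ltn_eqF // (bc (Ordinal jk)).
  by rewrite ltn_eqF ?(ltn_trans jk) // lt0 ?jk.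
- by case: eqP => //= _; exact: diag.
Qed.

Lemma zero_set_class_shatters : (0 < d)%N -> lin_indep f ->
  exists T : tree (zero_set_class f) (d - 1),
    well_labeled T /\ level_balanced T.
Proof.
move=> d_gt0 f_indep.
have [c [a [lt0 diag]]] := exists_triangular_points d_gt0 f_indep (leqnn d).
set M := \matrix_(i < d) f (c i).
have Munit : M^T \in unitmx.
  rewrite unitmx_tr -row_free_unit.
  apply: (triangular_row_free (a := fun i : 'I_d => a i)) => [j k jk|k].
    by rewrite lt0 ?jk /=.
  exact: diag.
(* A true branch prescribes 0, which puts the point in the zero set; the index [d - 1] falls outside
   the range of [insub] and gets 1. *)
pose v (tau : {ffun 'I_(d - 1) -> bool}) : 'rV[F]_d :=
  \row_i (if insub (val i) is Some k then (~~ tau k)%:R else 1).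
pose b tau := v tau *m invmx M^T.
have bE tau i : dot (b tau) (f (c (val i))) = v tau 0 i.
  by rewrite -(mulmx_tr_rows (fun i : 'I_d => f (c i))) mulmxKV.
have b_neq0 tau : b tau != 0.
  have last_lt : (d - 1 < d)%N by rewrite subn1 prednK.
  apply/eqP => b0; have /eqP := bE tau (Ordinal last_lt).
  rewrite b0 dotE mul0mx !mxE /= insubF ?ltnn //.
  by rewrite eq_sym oner_eq0.
have leafP tau : zero_set_class f (zero_set f (b tau)).
  by exists (b tau); first exact: b_neq0.
exists (Tree (fun (k : 'I_(d - 1)) _ => c k) leafP); split=> // tau k.
have kd : (k < d)%N by exact: leq_trans (ltn_ord k) (leq_subr _ _).
rewrite /= /zero_set /= (bE tau (Ordinal kd)) mxE /= valK.
by case: (tau k) => //; split=> // /eqP; rewrite oner_eq0.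
Qed.

Lemma well_labeled_depth_lt n (T : tree (zero_set_class f) n) :
  well_labeled T -> (n < d)%N.
Proof.
move=> T_wl.
have /choice[a aP] tau :
    exists a, a != 0 /\ zero_set f a = leaf T tau.
  by have [a a0 <-] := leaf_in T tau; exists a.
(* For [k < n], [path k] turns to false at level [k] and stays false. *)
pose path (k : nat) : {ffun 'I_n -> bool} := [ffun i : 'I_n => (i < k)%N].
pose c k := node T (Defs.restrict (path n) k).
have pathE (j : 'I_n) k : (j <= k)%N ->
    Defs.restrict (path k) j = Defs.restrict (path n) j.
  move=> jk; apply/ffunP => i; rewrite !ffunE /= (leq_trans (ltn_ord i) jk).
  by rewrite (ltn_trans (ltn_ord i)).
(* The case [j < k] gives the zeros, [j = k] the nonzero diagonal, and [k = n] the functional that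
   kills every node. *)
have dotP (j : 'I_n) (k : nat) : (j <= k)%N ->
    dot (a (path k)) (f (c j)) = 0 <-> (j < k)%N = true.
  move=> jk; have := T_wl (path k) j.
  by rewrite -(aP (path k)).2 pathE // ffunE.
apply: (@row_free_orthogonal_lt _ _ _ (fun j => f (c j)) (a (path n))).
- apply: (triangular_row_free (a := fun k : 'I_n => a (path k))) => [j k jk|k].
    exact: (dotP j k (ltnW jk)).2.
  by move/(dotP k k (leqnn k)); rewrite ltnn.
- exact: (aP (path n)).1.
- by move=> k; apply: (dotP k n (ltnW (ltn_ord k))).2; exact: ltn_ord.
Qed.

End ZeroSetDimension.

Theorem theorem3p10 (X : Type) (F : fieldType) (d : nat) (d_gt0 : (0 < d)%N)
    (f : X -> 'rV[F]_d) (f_indep : lin_indep f) :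
  VCdim (zero_set_class f) = Ldim (zero_set_class f) /\
  Ldim (zero_set_class f) = ((d - 1)%N%:E)%E.
Proof.
(* The level-balanced [T] attains both dimensions, and the bound for arbitrary well-labeled trees
   caps both. *)
have [T [T_wl T_lb]] := zero_set_class_shatters d_gt0 f_indep.
have depth_le m (T' : tree (zero_set_class f) m) :
    well_labeled T' -> (m <= d - 1)%N.
  by move=> /well_labeled_depth_lt md; rewrite subn1 -ltnS prednK.
have LdimE : Ldim (zero_set_class f) = ((d - 1)%N%:E)%E.
  by apply: largestE; split=> [|m [T' /depth_le]//]; exists T.
split=> //; rewrite LdimE.
by apply: largestE; split=> [|m [T' [/depth_le]]//]; exists T.
Qed.
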